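(* Let $\epsilon\ge 0$ and $\delta\in(0,1)$. Let $f_{+,\epsilon}\in\arg\max_{f\in\mathcal{R}(\epsilon)}MR(f)$ and $f_{-,\epsilon}\in\arg\min_{f\in\mathcal{R}(\epsilon)}MR(f)$. Suppose $f_{+,\epsilon}$ and $f_{-,\epsilon}$ each satisfy the bounded individual loss, bounded relative loss and bounded aggregate loss assumptions (with constants $B_{\text{ind}},B_{\text{ref}},b_{\text{orig}},B_{\text{switch}}$). Then $$\mathbb{P}\left(MCR_+(\epsilon)>\widehat{MCR}_+(\epsilon_1)+\mathcal{Q}_1\right)\le\delta,\qquad \mathbb{P}\left(MCR_-(\epsilon)<\widehat{MCR}_-(\epsilon_1)-\mathcal{Q}_1\right)\le\delta,$$ where $\epsilon_1:=\epsilon+2B_{\text{ref}}\sqrt{\frac{\log(3\delta^{-1})}{2n}}$ and $$\mathcal{Q}_1:=\frac{B_{\text{switch}}}{b_{\text{orig}}}-\frac{B_{\text{switch}}-B_{\text{ind}}\sqrt{\frac{\log(6\delta^{-1})}{n}}}{b_{\text{orig}}+B_{\text{ind}}\sqrt{\frac{\log(6\delta^{-1})}{2n}}}.$$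
   Context: Let $Z=(Y,X_1,X_2)$ be a random variable on $\mathcal{Z}=\mathcal{Y}\times\mathcal{X}_1\times\mathcal{X}_2$, $\mathcal{X}=\mathcal{X}_1\times\mathcal{X}_2$. A model class $\mathcal{F}$ is a set of measurable functions $\mathcal{X}\to\mathcal{Y}$; $L:\mathcal{F}\times\mathcal{Z}\to\mathbb{R}_{\ge0}$ is a nonnegative loss. The data are $n\ge2$ i.i.d. copies $(y_i,x_{1,i},x_{2,i})$, $i=1,\dots,n$, of $Z$. Define $e_{\text{orig}}(f)=\mathbb{E}L(f,Z)$; $e_{\text{switch}}(f)=\mathbb{E}L(f,(Y^{(b)},X_1^{(a)},X_2^{(b)}))$ with $Z^{(a)},Z^{(b)}$ independent copies of $Z$; $MR(f)=e_{\text{switch}}(f)/e_{\text{orig}}(f)$. Empirically, $\hat e_{\text{orig}}(f)=\frac1n\sum_i L(f,(y_i,x_{1,i},x_{2,i}))$, $\hat e_{\text{switch}}(f)=\frac{1}{n(n-1)}\sum_i\sum_{j\neq i}L(f,(y_j,x_{1,i},x_{2,j}))$, $\widehat{MR}(f)=\hat e_{\text{switch}}(f)/\hat e_{\text{orig}}(f)$. A reference model $f_{\text{ref}}\in\mathcal{F}$ is fixed in advance (not data dependent). Rashomon sets: $\mathcal{R}(\epsilon)=\{f\in\mathcal{F}:e_{\text{orig}}(f)\le e_{\text{orig}}(f_{\text{ref}})+\epsilon\}$ and $\hat{\mathcal{R}}(\epsilon)=\{f_{\text{ref}}\}\cup\{f\in\mathcal{F}:\hat e_{\text{orig}}(f)\le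 \hat e_{\text{orig}}(f_{\text{ref}})+\epsilon\}$. Model class reliance: $MCR_+(\epsilon)=\max_{f\in\mathcal{R}(\epsilon)}MR(f)$, $MCR_-(\epsilon)=\min_{f\in\mathcal{R}(\epsilon)}MR(f)$, $\widehat{MCR}_+(\epsilon)=\max_{f\in\hat{\mathcal{R}}(\epsilon)}\widehat{MR}(f)$, $\widehat{MCR}_-(\epsilon)=\min_{f\in\hat{\mathcal{R}}(\epsilon)}\widehat{MR}(f)$. Standing assumption: all maxima/minima over these sets exist. Assumptions for a model $f$ (with known constants): bounded individual loss: $0\le L(f,z)\le B_{\text{ind}}$ for all $z\in\mathcal{Z}$; bounded relative loss: $|L(f,z)-L(f_{\text{ref}},z)|\le B_{\text{ref}}$ for all $z\in\mathcal{Z}$; bounded aggregate loss: $\mathbb{P}\{0<b_{\text{orig}}\le\hat e_{\text{orig}}(f)\}=\mathbb{P}\{\hat e_{\text{switch}}(f)\le B_{\text{switch}}\}=1$. *)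

(* Defs.v *)
From HB Require Import structures.
From mathcomp Require Import all_boot all_order all_algebra.
From mathcomp Require Import all_classical all_reals all_analysis.
Set Implicit Arguments. Unset Strict Implicit. Unset Printing Implicit Defensive.
Import Order.TTheory GRing.Theory Num.Theory.
Import numFieldNormedType.Exports.
Local Open Scope classical_set_scope.
Local Open Scope ring_scope.

Section MCR.
Variables (R : realType) (d1 d2 d3 : measure_display).
Variables (Y : measurableType d1) (X1 : measurableType d2) (X2 : measurableType d3).

Definition Zt := (Y * X1 * X2)%type.
Definition model := (X1 * X2 -> Y)%type.

Variable (mu : probability Zt R).
Variable (L : model -> Zt -> R).

Definition e_orig (f : model) : R := fine (\int[mu]_z (L f z)%:E).

(* e_switch(f) = E L(f, (Y^(b), X1^(a), X2^(b))), Z^(a), Z^(b) independent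
   copies of Z (iterated integral w.r.t. the law of Z). *)
Definition e_switch (f : model) : R :=
  fine (\int[mu]_za \int[mu]_zb (L f ((zb.1.1, za.1.2), zb.2))%:E).

Definition MR (f : model) : R := e_switch f / e_orig f.

Definition rashomon (F : set model) (fref : model) (eps : R) : set model :=
  [set f | F f /\ e_orig f <= e_orig fref + eps].

Definition MCR_plus F fref eps : \bar R :=
  ereal_sup [set (MR f)%:E | f in rashomon F fref eps].
Definition MCR_minus F fref eps : \bar R :=
  ereal_inf [set (MR f)%:E | f in rashomon F fref eps].

Definition hat_e_orig (n : nat) (zs : 'I_n -> Zt) (f : model) : R :=
  n%:R^-1 * \sum_(i < n) L f (zs i).

Definition hat_e_switch (n : nat) (zs : 'I_n -> Zt) (f : model) : R :=
  (n * n.-1)%:R^-1 *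
  \sum_(i < n) \sum_(j < n | j != i) L f (((zs j).1.1, (zs i).1.2), (zs j).2).

Definition hat_MR n (zs : 'I_n -> Zt) (f : model) : R :=
  hat_e_switch zs f / hat_e_orig zs f.

Definition hat_rashomon (F : set model) (fref : model) (eps : R)
    n (zs : 'I_n -> Zt) : set model :=
  [set fref] `|` [set f | F f /\ hat_e_orig zs f <= hat_e_orig zs fref + eps].

Definition hat_MCR_plus F fref eps n (zs : 'I_n -> Zt) : \bar R :=
  ereal_sup [set (hat_MR zs f)%:E | f in hat_rashomon F fref eps zs].
Definition hat_MCR_minus F fref eps n (zs : 'I_n -> Zt) : \bar R :=
  ereal_inf [set (hat_MR zs f)%:E | f in hat_rashomon F fref eps zs].

End MCR.

Definition iid_sample (R : realType) (dO d : measure_display)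
    (Omega : measurableType dO) (T : measurableType d)
    (P : probability Omega R) (mu : probability T R)
    (n : nat) (Zs : 'I_n -> Omega -> T) : Prop :=
  (forall i, measurable_fun setT (Zs i)) /\
  (forall A : 'I_n -> set T, (forall i, measurable (A i)) ->
     P (\big[setI/setT]_(i < n) (Zs i @^-1` A i)) = \big[*%E/1%E]_(i < n) mu (A i)).

(* Outer-probability bound: the event E is contained in a measurable event
   of probability at most delta (equivalent to P E <= delta when E is
   measurable). *)
Definition prob_le (R : realType) (dO : measure_display)
    (Omega : measurableType dO) (P : probability Omega R)
    (E : set Omega) (delta : R) : Prop :=
  exists2 A, measurable A & (E `<=` A /\ (P A <= delta%:E)%E).

(* Main.v *)
Require Import Defs.
From HB Require Import structures.
From mathcomp Require Import all_boot all_order all_algebra.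
From mathcomp Require Import all_classical all_reals all_analysis.
From mathcomp Require Import measurable_realfun ring lra.
Set Implicit Arguments. Unset Strict Implicit. Unset Printing Implicit Defensive.
Import Order.TTheory GRing.Theory Num.Theory.
Import numFieldNormedType.Exports.
Local Open Scope classical_set_scope.
Local Open Scope ring_scope.

(** Outside an event of probability at most [delta], the extremal model [f]
belongs to the enlarged empirical Rashomon set and its empirical and population
losses are close: Hoeffding's inequality controls
[hat_e_orig f - hat_e_orig fref] (probability [delta / 3]) and [hat_e_orig f]
(probability [delta / 6]), and an analogue for U-statistics controls
[hat_e_switch f] (probability [delta / 6]).  Since
[x / y - (x - a) / (y + b)] increases in [x >= 0] and decreases in [y > 0], its
value at [(Bswitch, borig)], namely [Q1], bounds the gap between the ratios.

The constant in [Q1] asks for a U-statistic bound with exponent proportional to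
[n], whereas averaging over disjoint pairs gives only [2 * floor (n / 2)].
Finner's inequality is used instead: if every coordinate occurs in at
most [p] of the functions [u_i], then
[E exp (sum_i u_i) <= prod_i (E exp (p u_i))^(1/p)].  With the [n (n - 1)] ordered
pairs and [p = 2 (n - 1)] this gives the factor [n / 2] exactly; with single
coordinates and [p = 1] it gives Hoeffding's inequality for sample means. *)

(** * Calculus behind Hoeffding's lemma *)

Section hoeffding_analysis.
Context {R : realType}.
Implicit Types (p u x y s : R).

Lemma expR_tangent x s : expR s * (1 + (x - s)) <= expR x.
Proof.
rewrite -[in leRHS](subrK s x) expRD mulrC.
by rewrite ler_pM2r ?expR_gt0// expR_ge1Dx.
Qed.

(** The tangent at [y * u], evaluated at [0] and at [u], is averaged with weights [1 - y] and [y];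
    the linear terms cancel. *)
Lemma expR_chord y u : 0 <= y <= 1 -> expR (y * u) <= 1 - y + y * expR u.
Proof.
move=> /andP[y0 y1].
have h0 : expR (y * u) * (1 + (0 - y * u)) <= 1.
  by rewrite -[leRHS](@expR0 R) expR_tangent.
have h1 := expR_tangent u (y * u).
have {}h0 := ler_wpM2l (_ : 0 <= 1 - y) h0.
have {}h1 := ler_wpM2l y0 h1.
move: (expR (y * u)) (expR u) h0 h1 => e1 e2 h0 h1.
have := h0 ltac:(lra); lra.
Qed.

(** Mean value theorem. The sign of [df] is required on the half-line only, so that two applications
    in a row integrate a second-order bound. *)
Lemma is_derive_ge0 (f df : R -> R) u :
  (forall x, is_derive x 1 f (df x)) -> (forall x, 0 <= x -> 0 <= df x) ->
  0 <= u -> f 0 <= f u.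
Proof.
move=> fdf df0 u0.
have [->//|un0] := eqVneq u 0.
have u_gt0 : 0 < u by rewrite lt_neqAle eq_sym un0.
have cf : {within `[0, u], continuous f}.
  apply: continuous_subspaceT => x.
  by apply/differentiable_continuous/derivable1_diffP; have [] := fdf x.
have [c /[!in_itv]/= /andP[c0 _] fc] :=
  @MVT R f df 0 u u_gt0 (fun x _ => fdf x) cf.
by rewrite -subr_ge0 fc mulr_ge0 ?df0 ?subr0 // ltW.
Qed.

(** Mean of the Bernoulli law of parameter [p] tilted by [expR u]; it is the derivative in [u] of
    [ln (1 - p + p * expR u)]. *)
Let q p u := p * expR u / (1 - p + p * expR u).

Let den_gt0 p u : 0 <= p <= 1 -> 0 < 1 - p + p * expR u.
Proof.
move=> /andP[p0 p1]; have e0 := expR_gt0 u.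
have [->|pn0] := eqVneq p 0; first by rewrite mul0r addr0 subr0.
by rewrite ltr_wpDl ?subr_ge0// mulr_gt0// lt_neqAle eq_sym pn0.
Qed.

(** The difference of the logarithms of the two sides vanishes at [u = 0] together with its
    derivative, and its second derivative [1/4 - q (1 - q)] is a square. *)
Lemma hoeffding_two_point p u : 0 <= p <= 1 ->
  1 - p + p * expR u <= expR (p * u + u ^+ 2 / 8).
Proof.
(* For negative [u], exchange the two outcomes: [(p, u)] becomes [(1 - p, - u)], and both sides are
   multiplied by [expR u]. *)
wlog u0 : p u / 0 <= u => [hw p01|].
  have [/hw|u0] := leP 0 u; first exact.
  have /hw : 0 <= - u by rewrite oppr_ge0 ltW.
  move=> /(_ (1 - p)) h.
  have p01' : 0 <= 1 - p <= 1 by lra.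
  have := h p01'.
  rewrite -(ler_pM2r (expR_gt0 u)) -expRD mulrDl -mulrA -expRD addNr expR0.
  by congr (_ <= _); [ring|congr expR; field].
move=> p01.
have dend x : is_derive x 1 (fun v => 1 - p + p * expR v) (p * expR x).
  by apply: is_derive_eq; rewrite add0r /GRing.scale/=; ring.
(* Logistic identity: the derivative of [q p] is [q p * (1 - q p)]. *)
have qd x : is_derive x 1 (fun v => v / 4 - q p v) (4^-1 - q p x * (1 - q p x)).
  have d0 := lt0r_neq0 (den_gt0 x p01).
  have dV := @is_deriveV R (fun v => 1 - p + p * expR v) x (p * expR x) 1 d0 (dend x).
  rewrite /q; apply: is_derive_eq.
  rewrite /GRing.scale/= !(scaler0,mulr0,mulr1,add0r,addr0).
  by field.
have q_le x : 0 <= x -> 0 <= x / 4 + p - q p x.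
  move=> x0; suff : 0 / 4 - q p 0 <= x / 4 - q p x.
    by rewrite {1}/q expR0 mulr1 subrK; lra.
  apply: (is_derive_ge0 qd _ x0) => y _.
  have -> : 4^-1 - q p y * (1 - q p y) = (q p y - 2^-1) ^+ 2 by field.
  exact: sqr_ge0.
have gd x : is_derive x 1 (fun v => v ^+ 2 / 8 + p * v - ln (1 - p + p * expR v))
   (x / 4 + p - q p x).
  have d0 := den_gt0 x p01.
  have dl := is_derive1_ln d0.
  have dc := @is_derive1_comp R (@ln R) (fun v => 1 - p + p * expR v) x _ _ dl (dend x).
  apply: is_derive_eq.
  rewrite /GRing.scale/= /q; field.
  exact: lt0r_neq0.
have := is_derive_ge0 gd q_le u0.
rewrite expR0 mulr0 mulr1 subrK ln1 expr0n/= mul0r addr0 subr0 subr_ge0 => h.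
by rewrite -[leLHS]lnK ?posrE ?den_gt0// ler_expR [leRHS]addrC.
Qed.
End hoeffding_analysis.

(** * Bounded random variables, Hoeffding's lemma and Hoelder's inequality *)

(** The bound holds everywhere rather than almost surely: the property refers to no measure and
    gives integrability under every probability. *)
Definition bounded_mfun {R : realType} {d} {T : measurableType d} (X : T -> R) :=
  measurable_fun setT X /\ exists M, forall w, `|X w| <= M.

Section bounded_mfun.
Context {R : realType} {d : measure_display} {T : measurableType d}.
Implicit Types (X Y : T -> R) (P : probability T R).

Lemma bounded_mfun_cst (r : R) : bounded_mfun (fun _ : T => r).
Proof. by split; [exact: measurable_cst|exists `|r|]. Qed.

Lemma bounded_mfunD X Y : bounded_mfun X -> bounded_mfun Y ->
  bounded_mfun (fun w => X w + Y w).
Proof.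
move=> [mX [M XM]] [mY [N YN]]; split; first exact: measurable_funD.
by exists (M + N) => w; rewrite (le_trans (ler_normD _ _))// lerD.
Qed.

Lemma bounded_mfunZ (r : R) X : bounded_mfun X -> bounded_mfun (fun w => r * X w).
Proof.
move=> [mX [M XM]]; split; first exact: measurable_funM.
by exists (`|r| * M) => w; rewrite normrM ler_wpM2l.
Qed.

Lemma bounded_mfunB X Y : bounded_mfun X -> bounded_mfun Y ->
  bounded_mfun (fun w => X w - Y w).
Proof.
move=> bX /(bounded_mfunZ (-1)) bY.
by under eq_fun do rewrite -[X in _ - X]mul1r -mulNr; exact: bounded_mfunD.
Qed.

Lemma bounded_mfun_sum (I : Type) (s : seq I) (X : I -> T -> R) :
  (forall i, bounded_mfun (X i)) -> bounded_mfun (fun w => \sum_(i <- s) X i w).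
Proof.
move=> bX; elim: s => [|i s ih].
  by under eq_fun do rewrite big_nil; exact: bounded_mfun_cst.
by under eq_fun do rewrite big_cons; exact: bounded_mfunD.
Qed.

Lemma bounded_mfun_expR X : bounded_mfun X -> bounded_mfun (fun w => expR (X w)).
Proof.
move=> [mX [M XM]]; split; first exact: measurableT_comp.
exists (expR M) => w; rewrite ger0_norm ?expR_ge0// ler_expR.
by rewrite (le_trans (ler_norm _)).
Qed.

Lemma bounded_mfun_itv X a b : measurable_fun setT X ->
  (forall w, a <= X w <= b) -> bounded_mfun X.
Proof.
move=> mX Xab; split => //; exists (`|a| + `|b|) => w.
have /andP[aX Xb] := Xab w; rewrite ler_norml.
have := ler_norm (- a); have := ler_norm b; rewrite normrN => hb ha.
by have := normr_ge0 a; have := normr_ge0 b; lra.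
Qed.

Variable P : probability T R.

Lemma bounded_mfun_integrable X : bounded_mfun X -> P.-integrable setT (EFin \o X).
Proof.
move=> [mX [M XM]]; apply: measurable_bounded_integrable => //.
  by rewrite (le_lt_trans (probability_le1 P measurableT))// ltry.
exists M; split; first exact: num_real.
by move=> x Mx w _ /=; rewrite (le_trans (XM w))// ltW.
Qed.

Lemma bounded_mfun_EFin_Rintegral X : bounded_mfun X ->
  (\int[P]_w X w)%:E = (\int[P]_w (X w)%:E)%E.
Proof.
move=> bX; rewrite fineK//.
exact: integrable_fin_num (bounded_mfun_integrable bX).
Qed.

Lemma prob_Rintegral_cst r : \int[P]_(_ in setT) r = r :> R.
Proof.
by rewrite Rintegral_cst// [X in fine X](@probability_setT _ _ _ P) mulr1.
Qed.

Lemma prob_RintegralD X Y : bounded_mfun X -> bounded_mfun Y ->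
  \int[P]_w (X w + Y w) = \int[P]_w X w + \int[P]_w Y w.
Proof. by move=> bX bY; rewrite RintegralD//; exact: bounded_mfun_integrable. Qed.

Lemma prob_RintegralZ r X : bounded_mfun X ->
  \int[P]_w (r * X w) = r * \int[P]_w X w.
Proof. by move=> bX; rewrite RintegralZl//; exact: bounded_mfun_integrable. Qed.

Lemma prob_RintegralB X Y : bounded_mfun X -> bounded_mfun Y ->
  \int[P]_w (X w - Y w) = \int[P]_w X w - \int[P]_w Y w.
Proof. by move=> bX bY; rewrite RintegralB//; exact: bounded_mfun_integrable. Qed.

Lemma prob_le_Rintegral X Y : bounded_mfun X -> bounded_mfun Y ->
  (forall w, X w <= Y w) -> \int[P]_w X w <= \int[P]_w Y w.
Proof. by move=> bX bY XY; rewrite le_Rintegral//; exact: bounded_mfun_integrable. Qed.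

Lemma prob_Rintegral_sum (I : Type) (s : seq I) (X : I -> T -> R) :
  (forall i, bounded_mfun (X i)) ->
  \int[P]_w (\sum_(i <- s) X i w) = \sum_(i <- s) \int[P]_w X i w.
Proof.
move=> bX; elim: s => [|i s ih].
  under eq_Rintegral do rewrite big_nil.
  by rewrite big_nil prob_Rintegral_cst.
under eq_Rintegral do rewrite big_cons.
by rewrite prob_RintegralD ?ih ?big_cons//; exact: bounded_mfun_sum.
Qed.

Lemma Rintegral_expR_gt0 X : bounded_mfun X -> 0 < \int[P]_w expR (X w).
Proof.
move=> bX; have [_ [M XM]] := bX.
apply: (@lt_le_trans _ _ (expR (- M))); first exact: expR_gt0.
rewrite -[leLHS]prob_Rintegral_cst; apply: prob_le_Rintegral.
- exact: bounded_mfun_cst.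
- exact: bounded_mfun_expR.
by move=> w; rewrite ler_expR; have := XM w; rewrite ler_norml => /andP[].
Qed.

(** Hoeffding's lemma: by convexity, the worst case is the law on [{a, b}] with the same mean, which
    [hoeffding_two_point] controls. *)
Lemma hoeffding_mgf X a b s : measurable_fun setT X -> a < b ->
  (forall w, a <= X w <= b) ->
  \int[P]_w expR (s * (X w - \int[P]_v X v)) <= expR (s ^+ 2 * (b - a) ^+ 2 / 8).
Proof.
move=> mX ab Xab; have bX := bounded_mfun_itv mX Xab.
set m := \int[P]_v X v; have ba0 : 0 < b - a by rewrite subr_gt0.
(* [q] is the mass at [b] of the law on [{a, b}] with mean [m]. *)
pose q := (m - a) / (b - a); pose e := expR (s * (b - a)).
have mab : a <= m <= b.
  rewrite -[a]prob_Rintegral_cst -[b]prob_Rintegral_cst.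
  by apply/andP; split; apply: prob_le_Rintegral => //;
    try exact: bounded_mfun_cst; move=> w; have /andP[] := Xab w.
have q01 : 0 <= q <= 1.
  by rewrite divr_ge0 ?ler_pdivrMr ?mul1r; move: mab; lra.
(* The chord over [[a, b]] is affine in [X w], so its expectation depends on [X] through [m]
   alone. *)
have chord w : expR (s * (X w - m)) <=
    expR (s * (a - m)) * (1 - (X w - a) / (b - a) + (X w - a) / (b - a) * e).
  rewrite (_ : s * (X w - m) = s * (a - m) + (X w - a) / (b - a) * (s * (b - a))).
    rewrite expRD ler_pM2l ?expR_gt0//; apply: expR_chord.
    by rewrite divr_ge0 ?ler_pdivrMr ?mul1r; have := Xab w; lra.
  by field; exact: lt0r_neq0.
have aff w : expR (s * (a - m)) * (1 - (X w - a) / (b - a) + (X w - a) / (b - a) * e) =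
    expR (s * (a - m)) * (1 - a * (e - 1) / (b - a)) +
    expR (s * (a - m)) * (e - 1) / (b - a) * X w.
  by field; exact: lt0r_neq0.
apply: (@le_trans _ _ (expR (s * (a - m)) * (1 - q + q * e))).
  rewrite (_ : expR (s * (a - m)) * (1 - q + q * e) =
    expR (s * (a - m)) * (1 - a * (e - 1) / (b - a)) +
    expR (s * (a - m)) * (e - 1) / (b - a) * m); last first.
    by rewrite /q; field; exact: lt0r_neq0.
  rewrite -prob_RintegralZ// -[X in X + _]prob_Rintegral_cst -prob_RintegralD;
    [|exact: bounded_mfun_cst|exact: bounded_mfunZ].
  apply: prob_le_Rintegral.
  - apply/bounded_mfun_expR/bounded_mfunZ/bounded_mfunB => //.
    exact: bounded_mfun_cst.
  - by apply: bounded_mfunD; [exact: bounded_mfun_cst|exact: bounded_mfunZ].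
  by move=> w; rewrite -aff.
(* Since [q * (b - a) = m - a], the linear terms of the exponent cancel. *)
rewrite (_ : s ^+ 2 * _ / 8 = s * (a - m) + (q * (s * (b - a)) + (s * (b - a)) ^+ 2 / 8)).
  by rewrite expRD ler_pM2l ?expR_gt0// hoeffding_two_point.
by rewrite /q; field; exact: lt0r_neq0.
Qed.

(** Hoelder's inequality for at most [p] non-constant factors, indexed by [S], all with exponent
    [p]; a factor outside [S] equals its own norm. The product of norms is written as the
    exponential of a sum, so that it can serve again as an integrand of the same shape. *)
Lemma hoelder_expR (I : finType) (S : {pred I}) (p : nat) (x : I -> T -> R) :
  (0 < p)%N -> (#|S| <= p)%N -> (forall i, bounded_mfun (x i)) ->
  (forall i, i \notin S -> forall w w', x i w = x i w') ->
  \int[P]_w expR (\sum_i x i w) <=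
  expR (\sum_i p%:R^-1 * ln (\int[P]_w expR (p%:R * x i w))).
Proof.
move=> p0 Sp bx xcst; have p0' : 0 < p%:R :> R by rewrite ltr0n.
(* [v i] is the logarithm of the [p]-norm of [expR (x i)]. *)
pose v i := p%:R^-1 * ln (\int[P]_w expR (p%:R * x i w)).
have bpx i : bounded_mfun (fun w => p%:R * x i w) by exact: bounded_mfunZ.
have expv i : expR (p%:R * v i) = \int[P]_w expR (p%:R * x i w).
  rewrite /v mulrA divff ?gt_eqF// mul1r lnK// posrE.
  exact: Rintegral_expR_gt0.
have xv i w : i \notin S -> x i w = v i.
  move=> iS; rewrite /v (_ : (fun w => _) = fun=> expR (p%:R * x i w)).
    by rewrite prob_Rintegral_cst expRK mulrA mulVf ?mul1r// gt_eqF.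
  by apply/funext => w'; rewrite (xcst i iS w w').
(* [expR (y i)] is the [p]-th power of the normalized factor and has expectation one. *)
pose y i w := p%:R * x i w - p%:R * v i.
have by_ i : bounded_mfun (y i).
  by apply: bounded_mfunB => //; exact: bounded_mfun_cst.
(* AM-GM for the normalized factors, padded with [p - #|S|] ones; it follows from
   the tangent line of [expR] at [t]. *)
have amgm w : expR (\sum_i x i w) <= expR (\sum_i v i) * p%:R^-1 *
    (\sum_(i in S) expR (y i w) + (p - #|S|)%:R).
  set t := \sum_(i in S) (x i w - v i).
  have -> : \sum_i x i w = \sum_i v i + t.
    rewrite (bigID (mem S) predT)/= [X in _ = X + _](bigID (mem S) predT)/=.
    rewrite /t sumrB [X in _ + X = _](eq_bigr v) => [|i]; last exact: xv.
    ring.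
  rewrite expRD -mulrA ler_pM2l ?expR_gt0// ler_pdivlMl//.
  have sum_ge : \sum_(i in S) expR t * (1 + (y i w - t)) <= \sum_(i in S) expR (y i w).
    by apply: ler_sum => i _; exact: expR_tangent.
  have cst_ge : (p - #|S|)%:R * (expR t * (1 + (0 - t))) <= (p - #|S|)%:R.
    by rewrite -[leRHS]mulr1 ler_wpM2l// -[leRHS](@expR0 R) expR_tangent.
  apply: le_trans (lerD sum_ge cst_ge).
  rewrite -mulr_sumr big_split/= sumrB !sumr_const.
  rewrite (_ : \sum_(i in S) y i w = p%:R * t).
    by rewrite natrB// -mulr_natl; lra.
  by rewrite mulr_sumr; apply: eq_bigr => i _; rewrite mulrBr.
have bsum : bounded_mfun (fun w => \sum_(i in S) expR (y i w)).
  under eq_fun do rewrite -big_enum.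
  by apply: bounded_mfun_sum => i; exact: bounded_mfun_expR.
have bsumc : bounded_mfun (fun w => \sum_(i in S) expR (y i w) + (p - #|S|)%:R).
  by apply: bounded_mfunD => //; exact: bounded_mfun_cst.
apply: (@le_trans _ _ (\int[P]_w (expR (\sum_i v i) * p%:R^-1 *
    (\sum_(i in S) expR (y i w) + (p - #|S|)%:R)))).
  apply: prob_le_Rintegral => //; last exact: bounded_mfunZ.
  exact/bounded_mfun_expR/bounded_mfun_sum.
rewrite prob_RintegralZ// prob_RintegralD//; last exact: bounded_mfun_cst.
rewrite prob_Rintegral_cst.
(* The [#|S|] normalized terms and the padding [p - #|S|] add up to [p], which cancels [p^-1]. *)
rewrite (_ : \int[P]_w _ = #|S|%:R).
  by rewrite natrB// addrC subrK -mulrA mulVf ?mulr1// gt_eqF.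
under eq_Rintegral do rewrite -big_enum.
rewrite prob_Rintegral_sum => [|i]; last exact: bounded_mfun_expR.
rewrite big_enum/= (eq_bigr (fun=> 1)) ?sumr_const// => i _.
under eq_Rintegral do rewrite /y expRD mulrC.
rewrite prob_RintegralZ; last exact: bounded_mfun_expR.
by rewrite -expv -expRD addNr expR0.
Qed.

End bounded_mfun.

(** * Independence and joint laws for i.i.d. samples *)

Section independence.
Context {R : realType} {dO d : measure_display} {Omega : measurableType dO}
  {T : measurableType d}.
Variables (P : probability Omega R) (mu : probability T R).

(** Factorization on rectangles identifies the joint law with the product of [mu] and the law of
    [Y]; Tonelli's theorem does the rest. *)
Lemma ge0_integral_indep_pair d' (T' : measurableType d')
    (X : Omega -> T) (Y : Omega -> T') (f : T * T' -> \bar R) :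
  measurable_fun setT X -> measurable_fun setT Y ->
  (forall A B, measurable A -> measurable B ->
    P (X @^-1` A `&` Y @^-1` B) = (mu A * P (Y @^-1` B))%E) ->
  measurable_fun setT f -> (forall z, 0 <= f z)%E ->
  (\int[P]_w f (X w, Y w) = \int[P]_w \int[mu]_t f (t, Y w))%E.
Proof.
move=> mX mY XY mf f0.
pose Ym : {mfun Omega >-> T'} := HB.pack Y (isMeasurableFun.Build _ _ _ _ Y mY).
have mXY : measurable_fun setT (fun w => (X w, Y w)) by exact: measurable_fun_pair.
pose XYm : {mfun Omega >-> (T * T')%type} :=
  HB.pack (fun w => (X w, Y w)) (isMeasurableFun.Build _ _ _ _ _ mXY).
have prodE : forall A, measurable A ->
    (mu \x distribution P Ym)%E A = distribution P XYm A.
  apply: product_measure_unique => A B mA mB.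
  by rewrite /= /distribution /pushforward/= -XY.
transitivity (\int[distribution P XYm]_z f z)%E.
  by rewrite ge0_integral_distribution.
rewrite (eq_measure_integral (mu \x distribution P Ym)%E); last first.
  by move=> A mA _; exact/esym/prodE.
rewrite fubini_tonelli2// ge0_integral_distribution//.
  exact: measurable_fun_fubini_tonelli_G.
by move=> t; exact: integral_ge0.
Qed.

Lemma iid_sample_preimage n (Zs : 'I_n -> Omega -> T) i A :
  iid_sample P mu Zs -> measurable A -> P (Zs i @^-1` A) = mu A.
Proof.
move=> [mZ ind] mA.
have := ind (fun k => if k == i then A else setT).
rewrite (bigD1 i)//= eqxx big1 => [|k /negbTE->]; last by rewrite preimage_setT.
rewrite setIT (bigD1 i)//= eqxx big1 ?mule1; last first.
  by move=> k /negbTE ->; rewrite probability_setT.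
by apply => k; case: ifP.
Qed.

Lemma iid_sample_pair n (Zs : 'I_n -> Omega -> T) i j A B :
  iid_sample P mu Zs -> i != j -> measurable A -> measurable B ->
  P (Zs i @^-1` A `&` Zs j @^-1` B) = (mu A * P (Zs j @^-1` B))%E.
Proof.
move=> iid ij mA mB; rewrite (iid_sample_preimage _ iid)//; have [mZ ind] := iid.
have ji : j != i by rewrite eq_sym.
have := ind (fun k => if k == i then A else if k == j then B else setT).
rewrite (bigD1 i)//= eqxx (bigD1 j)//= (negbTE ji) eqxx big1; last first.
  by move=> k /andP[/negbTE-> /negbTE->]; rewrite preimage_setT.
rewrite setIT (bigD1 i)//= eqxx (bigD1 j)//= (negbTE ji) eqxx big1 ?mule1; last first.
  by move=> k /andP[/negbTE-> /negbTE->]; rewrite probability_setT.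
by apply => k; case: ifP => // _; case: ifP.
Qed.

(** Packing the sample into a tuple gives functionals of the data a measurable domain and allows
    induction on head and tail. *)
Definition sample_tuple n (Zs : 'I_n -> Omega -> T) (w : Omega) : n.-tuple T :=
  [tuple Zs i w | i < n].

Lemma measurable_sample_tuple n (Zs : 'I_n -> Omega -> T) :
  (forall i, measurable_fun setT (Zs i)) -> measurable_fun setT (sample_tuple Zs).
Proof.
move=> mZ; apply/measurable_fun_tnthP => i.
rewrite (_ : _ \o _ = Zs i)//; apply/funext => w /=.
by rewrite /sample_tuple tnth_mktuple.
Qed.

Definition sample_tail n (Zs : 'I_n.+1 -> Omega -> T) (i : 'I_n) := Zs (lift ord0 i).

Lemma sample_tupleS n (Zs : 'I_n.+1 -> Omega -> T) w :
  sample_tuple Zs w = [tuple of Zs ord0 w :: sample_tuple (sample_tail Zs) w].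
Proof.
apply: eq_from_tnth => i; rewrite tnth_mktuple.
case: (unliftP ord0 i) => [j|] ->; last by rewrite tnth0.
by rewrite tnthS tnth_mktuple.
Qed.

Lemma iid_sample_tail n (Zs : 'I_n.+1 -> Omega -> T) :
  iid_sample P mu Zs -> iid_sample P mu (sample_tail Zs).
Proof.
move=> [mZ ind]; split => [i|A mA]; first exact: mZ.
have := ind (fun k => if unlift ord0 k is Some j then A j else setT).
rewrite !big_ord_recl/= !unlift_none preimage_setT setTI probability_setT mul1e.
under eq_bigr do rewrite liftK.
under [in RHS]eq_bigr do rewrite liftK.
by apply => k; case: unliftP.
Qed.

(** Measurable boxes, a pi-system that generates the sigma-algebra of tuples. *)
Let rectangles n : set (set (n.-tuple T)) :=
  [set B | exists2 A : 'I_n -> set T, (forall i, measurable (A i)) &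
    B = \big[setI/setT]_(i < n) ((fun t : n.-tuple T => tnth t i) @^-1` A i)].

Let measurable_rectangles n :
  @measurable _ (n.-tuple T) = <<s @rectangles n >>.
Proof.
apply/seteqP; split.
  apply: smallest_sub; first exact: smallest_sigma_algebra.
  rewrite -bigcup_seq; apply: bigcup_sub => i _ _ [A mA <-] /=.
  apply: sub_sigma_algebra; exists (fun k => if k == i then A else setT).
    by move=> k; case: ifP.
  rewrite setTI (bigD1 i)//= eqxx big1 ?setIT//.
  by move=> k /negbTE ->; rewrite preimage_setT.
apply: smallest_sub; first exact: sigma_algebra_measurable.
move=> _ [A mA ->]; apply: bigsetI_measurable => i _.
by rewrite -[X in measurable X]setTI; apply: measurable_tnth.
Qed.

(** [iid_sample] gives the product formula on boxes only. Both sides are finite measures in [B], so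
    their agreement on boxes extends to all measurable sets. *)
Lemma iid_sample_head_tail n (Zs : 'I_n.+1 -> Omega -> T) A B :
  iid_sample P mu Zs -> measurable A -> measurable B ->
  P (Zs ord0 @^-1` A `&` sample_tuple (sample_tail Zs) @^-1` B) =
  (mu A * P (sample_tuple (sample_tail Zs) @^-1` B))%E.
Proof.
move=> iid mA mB; have [mZ ind] := iid.
have iid' := iid_sample_tail iid; have [mZ' ind'] := iid'.
have mW := measurable_sample_tuple mZ'.
set W := sample_tuple _ in mW *.
have mZA : measurable (Zs ord0 @^-1` A).
  by rewrite -[X in measurable X]setTI; exact: mZ.
pose Wm : {mfun Omega >-> n.-tuple T} := HB.pack W (isMeasurableFun.Build _ _ _ _ W mW).
have muA0 : 0 <= fine (mu A) by rewrite fine_ge0.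
pose m1 := pushforward (mrestr P mZA) W : {measure set (n.-tuple T) -> \bar R}.
pose m2 := mscale (NngNum muA0) (distribution P Wm).
have E1 C : m1 mW C = P (Zs ord0 @^-1` A `&` W @^-1` C) by rewrite setIC.
have E2 C : m2 C = (mu A * P (W @^-1` C))%E.
  by rewrite /m2 /mscale/= fineK// fin_num_measure.
rewrite -E1 -E2.
apply: (measure_unique (@rectangles n) (fun=> setT)) => //.
- exact: measurable_rectangles.
- move=> _ _ [C mC ->] [D mD ->]; exists (fun i => C i `&` D i).
    by move=> i; exact: measurableI.
  by rewrite -big_split.
- move=> _; exists (fun=> setT) => //; rewrite big1// => i _.
- by rewrite bigcup_const.
- move=> _ [C mC ->]; rewrite E1 [RHS]E2.
  have WC : W @^-1` (\big[setI/setT]_(i < n) ((fun t => tnth t i) @^-1` C i)) =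
      \big[setI/setT]_(i < n) (sample_tail Zs i @^-1` C i).
    rewrite (big_morph _ (preimage_setI _) (preimage_setT _)).
    apply: eq_bigr => i _; apply/seteqP.
    by split => w; rewrite /preimage/= /W tnth_mktuple.
  rewrite WC ind'//.
  (* Product formula for the whole sample, with [A] at [ord0] and [C] shifted by one. *)
  have := ind (fun k => if unlift ord0 k is Some j then C j else A).
  rewrite !big_ord_recl/= !unlift_none.
  under eq_bigr do rewrite liftK.
  under [in RHS]eq_bigr do rewrite liftK.
  by apply => k; case: unliftP.
- move=> _; rewrite E1 preimage_setT setIT.
  by rewrite (le_lt_trans (probability_le1 P _))// ltry.
Qed.

End independence.

(** * Finner's inequality and the resulting Chernoff bound *)

Section finner.
Context {R : realType} {dO d : measure_display} {Omega : measurableType dO}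
  {T : measurableType d}.
Variables (P : probability Omega R) (mu : probability T R).

Lemma bounded_mfun_comp d1 d2 (T1 : measurableType d1) (T2 : measurableType d2)
    (f : T2 -> R) (X : T1 -> T2) :
  bounded_mfun f -> measurable_fun setT X -> bounded_mfun (fun w => f (X w)).
Proof.
move=> [mf [M fM]] mX; split; first exact: measurableT_comp.
by exists M => w.
Qed.

Lemma bounded_mfun_pair d' (T' : measurableType d') (f : T * T' -> R) y :
  bounded_mfun f -> bounded_mfun (fun t => f (t, y)).
Proof. by move=> bf; apply: bounded_mfun_comp bf _; exact: pair2_measurable. Qed.

(** Meant for [M] a bound of the absolute value: the shifted integrand is then nonnegative and
    Tonelli's theorem applies. *)
Lemma Rintegral_shift (f : T -> R) M : bounded_mfun f ->
  \int[mu]_t f t = \int[mu]_t (f t + M) - M.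
Proof.
move=> bf; rewrite prob_RintegralD//; last exact: bounded_mfun_cst.
by rewrite prob_Rintegral_cst addrK.
Qed.

Lemma bounded_mfun_Rintegral d' (T' : measurableType d') (f : T * T' -> R) :
  bounded_mfun f -> bounded_mfun (fun y => \int[mu]_t f (t, y)).
Proof.
move=> bf; have [mf [M fM]] := bf.
pose g z := f z + M; have bg : bounded_mfun g.
  by apply: bounded_mfunD bf _; exact: bounded_mfun_cst.
have g0 z : 0 <= g z by have := fM z; rewrite ler_norml /g; lra.
have fgE y : \int[mu]_t f (t, y) = \int[mu]_t g (t, y) - M.
  by rewrite (@Rintegral_shift _ M)//; exact: bounded_mfun_pair.
split.
  under eq_fun do rewrite fgE; apply: measurable_funB => //.
  apply/measurable_EFinP.
  rewrite (_ : _ \o _ = fubini_G mu (EFin \o g)).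
    apply: measurable_fun_fubini_tonelli_G; first by apply/measurable_EFinP; case: bg.
    by move=> z; rewrite lee_fin.
  apply/funext => y; apply: bounded_mfun_EFin_Rintegral.
  exact: bounded_mfun_pair.
have bfy y := bounded_mfun_pair y bf.
exists M => y; rewrite ler_norml.
rewrite -[- M](prob_Rintegral_cst mu) -[X in _ && (_ <= X)](prob_Rintegral_cst mu).
by apply/andP; split; apply: prob_le_Rintegral => //; try exact: bounded_mfun_cst;
  move=> t; have := fM (t, y); rewrite ler_norml => /andP[].
Qed.

(** Signed form of [ge0_integral_indep_pair]: a bound of [f] is added and then cancelled on both
    sides. *)
Lemma Rintegral_indep_pair d' (T' : measurableType d')
    (X : Omega -> T) (Y : Omega -> T') (f : T * T' -> R) :
  measurable_fun setT X -> measurable_fun setT Y ->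
  (forall A B, measurable A -> measurable B ->
    P (X @^-1` A `&` Y @^-1` B) = (mu A * P (Y @^-1` B))%E) ->
  bounded_mfun f ->
  \int[P]_w f (X w, Y w) = \int[P]_w \int[mu]_t f (t, Y w).
Proof.
move=> mX mY XY bf; have [mf [M fM]] := bf.
pose g z := f z + M; have bg : bounded_mfun g.
  by apply: bounded_mfunD bf _; exact: bounded_mfun_cst.
have g0 z : 0 <= g z by have := fM z; rewrite ler_norml /g; lra.
have gE : \int[P]_w g (X w, Y w) = \int[P]_w \int[mu]_t g (t, Y w).
  rewrite [LHS]/Rintegral (@ge0_integral_indep_pair _ _ _ _ _ P mu _ _ _ _ (EFin \o g))//.
    congr fine; apply: eq_integral => w _.
    by rewrite bounded_mfun_EFin_Rintegral//; exact: bounded_mfun_pair.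
  by apply/measurable_EFinP; case: bg.
have bfXY : bounded_mfun (fun w => f (X w, Y w)).
  by apply: bounded_mfun_comp bf _; exact: measurable_fun_pair.
have bfY : bounded_mfun (fun w => \int[mu]_t f (t, Y w)).
  exact: bounded_mfun_comp (bounded_mfun_Rintegral bf) mY.
apply: (@addIr _ M); rewrite -[X in _ + X](prob_Rintegral_cst P).
rewrite -[X in _ = _ + X](prob_Rintegral_cst P).
rewrite -!prob_RintegralD; try exact: bounded_mfun_cst; try by [].
rewrite [LHS]gE; apply: eq_Rintegral => w _.
rewrite prob_RintegralD; [|exact: bounded_mfun_pair|exact: bounded_mfun_cst].
by rewrite prob_Rintegral_cst.
Qed.

Lemma Rintegral_iid n (Zs : 'I_n -> Omega -> T) i (f : T -> R) :
  iid_sample P mu Zs -> bounded_mfun f -> \int[P]_w f (Zs i w) = \int[mu]_t f t.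
Proof.
move=> iid bf; have [mZ _] := iid; have [mf _] := bf.
pose Zm : {mfun Omega >-> T} := HB.pack (Zs i) (isMeasurableFun.Build _ _ _ _ _ (mZ i)).
rewrite /Rintegral; congr fine.
transitivity (\int[distribution P Zm]_t (f t)%:E)%E; last first.
  by apply: eq_measure_integral => A mA _; exact: (iid_sample_preimage _ iid).
rewrite integral_distribution//; first exact/measurable_EFinP.
exact: (bounded_mfun_integrable P (bounded_mfun_comp bf (mZ i))).
Qed.

Lemma Rintegral_iid_pair n (Zs : 'I_n -> Omega -> T) i j (g : T * T -> R) :
  iid_sample P mu Zs -> i != j -> bounded_mfun g ->
  \int[P]_w g (Zs i w, Zs j w) = \int[mu]_s \int[mu]_t g (t, s).
Proof.
move=> iid ij bg; have [mZ _] := iid.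
rewrite Rintegral_indep_pair//.
  apply: (Rintegral_iid j (f := fun s => \int[mu]_t g (t, s))) => //.
  exact: bounded_mfun_Rintegral.
by move=> A B mA mB; exact: iid_sample_pair.
Qed.

(* Finner's inequality: Hoelder applied to one coordinate at a time. *)
Lemma finner_expR n (Zs : 'I_n -> Omega -> T) (I : finType)
    (u : I -> n.-tuple T -> R) (D : I -> {pred 'I_n}) (p : nat) :
  iid_sample P mu Zs -> (0 < p)%N -> (forall i, bounded_mfun (u i)) ->
  (forall i t t', (forall k, k \in D i -> tnth t k = tnth t' k) -> u i t = u i t') ->
  (forall k, (#|[pred i | k \in D i]| <= p)%N) ->
  \int[P]_w expR (\sum_i u i (sample_tuple Zs w)) <=
  expR (\sum_i p%:R^-1 * ln (\int[P]_w expR (p%:R * u i (sample_tuple Zs w)))).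
Proof.
move=> iid p0; have p0' : 0 < p%:R :> R by rewrite ltr0n.
elim: n Zs u D iid => [|n IH] Zs u D iid bu uD Dp.
  have W0 w : sample_tuple Zs w = [tuple] by rewrite tuple0.
  under eq_Rintegral do rewrite W0.
  rewrite prob_Rintegral_cst ler_expR; apply: ler_sum => i _.
  under eq_Rintegral do rewrite W0.
  by rewrite prob_Rintegral_cst expRK mulrA mulVf ?mul1r// gt_eqF.
have [mZ _] := iid; have iid' := iid_sample_tail iid.
have [mZ' _] := iid'; have mW' := measurable_sample_tuple mZ'.
pose cns (z : T * n.-tuple T) : n.+1.-tuple T := [tuple of z.1 :: z.2].
have mcns : measurable_fun setT cns by exact: measurable_cons.
have WE w : sample_tuple Zs w = cns (Zs ord0 w, sample_tuple (sample_tail Zs) w).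
  by rewrite sample_tupleS.
have integralE (f : n.+1.-tuple T -> R) : bounded_mfun f ->
    \int[P]_w expR (f (sample_tuple Zs w)) =
    \int[P]_w \int[mu]_t expR (f (cns (t, sample_tuple (sample_tail Zs) w))).
  move=> bf; under eq_Rintegral do rewrite WE.
  apply: (Rintegral_indep_pair (f := fun z => expR (f (cns z)))) => //.
  - by move=> A B mA mB; exact: iid_sample_head_tail.
  - by apply: bounded_mfun_expR; exact: bounded_mfun_comp bf mcns.
(* Logarithm of the [p]-norm of the [i]-th factor in the head coordinate alone, as a function of the
   tail. *)
pose v i (s : n.-tuple T) := p%:R^-1 * ln (\int[mu]_t expR (p%:R * u i (cns (t, s)))).
have bcns (f : n.+1.-tuple T -> R) : bounded_mfun f -> bounded_mfun (fun z => f (cns z)).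
  by move=> bf; exact: bounded_mfun_comp bf mcns.
have bpu i : bounded_mfun (fun z => p%:R * u i (cns z)).
  by apply: bounded_mfunZ; exact: bcns.
have expv i s : expR (p%:R * v i s) = \int[mu]_t expR (p%:R * u i (cns (t, s))).
  rewrite /v mulrA divff ?gt_eqF// mul1r lnK// posrE.
  by apply: Rintegral_expR_gt0; exact: (bounded_mfun_pair s (bpu i)).
(* The bound of [u i] passes to [v i], which makes [v] admissible in the induction hypothesis. *)
have bv i : bounded_mfun (v i).
  have [m_ _] := bounded_mfun_Rintegral (bounded_mfun_expR (bpu i)).
  have [_ [M uM]] := bu i.
  have mv : measurable_fun setT (v i).
    by apply: measurable_funM => //; exact: measurableT_comp m_.
  apply: (@bounded_mfun_itv _ _ _ _ (- M) M) => // s.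
  have be : bounded_mfun (fun t => expR (p%:R * u i (cns (t, s)))).
    exact: (bounded_mfun_pair s (bounded_mfun_expR (bpu i))).
  rewrite -(ler_pM2l p0') -[X in _ && X](ler_pM2l p0') -ler_expR.
  rewrite -[X in _ && X]ler_expR expv.
  rewrite -[expR (_ * - _)](prob_Rintegral_cst mu).
  rewrite -[expR (_ * M)](prob_Rintegral_cst mu).
  apply/andP; split; apply: prob_le_Rintegral => //;
    try exact: bounded_mfun_cst; move=> t; rewrite ler_expR ler_pM2l//.
    by have := uM (cns (t, s)); rewrite ler_norml => /andP[].
  exact: le_trans (ler_norm _) (uM _).
(* The head is integrated first: for a fixed tail, only the factors with [ord0 \in D i] vary, and
   there are at most [p] of them. *)
apply: (@le_trans _ _ (\int[P]_w expR (\sum_i v i (sample_tuple (sample_tail Zs) w)))).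
  rewrite (integralE (fun t => \sum_i u i t)); last exact: bounded_mfun_sum.
  apply: prob_le_Rintegral.
  - apply: (bounded_mfun_comp
      (f := fun s => \int[mu]_t expR (\sum_i u i (cns (t, s))))) => //.
    apply: (@bounded_mfun_Rintegral _ _ (fun z => expR (\sum_i u i (cns z)))).
    by apply/bounded_mfun_expR/bounded_mfun_sum => i; exact: bcns.
  - apply: (bounded_mfun_comp (f := fun s => expR (\sum_i v i s))) => //.
    by apply/bounded_mfun_expR/bounded_mfun_sum.
  move=> w; apply: (@hoelder_expR _ _ _ mu _ [pred i | ord0 \in D i]) => //.
  - exact: Dp.
  - by move=> i; exact: (bounded_mfun_pair _ (bcns _ (bu i))).
  - move=> i; rewrite inE => iD t t'; apply: uD => k.
    case: (unliftP ord0 k) => [j|] ->; first by rewrite !tnthS.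
    by rewrite (negbTE iD).
pose D' i : {pred 'I_n} := [pred k | lift ord0 k \in D i].
have vD' i s s' : (forall k, k \in D' i -> tnth s k = tnth s' k) -> v i s = v i s'.
  move=> ss'; rewrite /v; congr (_ * ln _).
  apply: eq_Rintegral => t _; congr (expR (_ * _)); apply: uD => k.
  case: (unliftP ord0 k) => [j|] -> kD; last by rewrite !tnth0.
  by rewrite !tnthS; apply: ss'.
have D'p k : (#|[pred i | k \in D' i]| <= p)%N by exact: (Dp (lift ord0 k)).
apply: (le_trans (IH _ v D' iid' bv vD' D'p)).
rewrite ler_expR; apply: ler_sum => i _.
(* Nothing is lost here: [expR (p * v i)] is the head integral of [expR (p * u i)], so the two
   integrations recombine. *)
rewrite (integralE (fun t => p%:R * u i t)); last exact: bounded_mfunZ.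
by under eq_Rintegral do rewrite expv.
Qed.

(** Chernoff's method: Finner's inequality separates the terms at the price of replacing [s] by
    [p * s], and Hoeffding's lemma bounds each one. *)
Lemma hoeffding_janson n (Zs : 'I_n -> Omega -> T) (I : finType)
    (F : I -> n.-tuple T -> R) (D : I -> {pred 'I_n}) (p : nat) (a b t : R) :
  iid_sample P mu Zs -> (0 < p)%N -> (0 < #|I|)%N -> a < b -> 0 < t ->
  (forall i, measurable_fun setT (F i)) ->
  (forall i s, a <= F i s <= b) ->
  (forall i s s', (forall k, k \in D i -> tnth s k = tnth s' k) -> F i s = F i s') ->
  (forall k, (#|[pred i | k \in D i]| <= p)%N) ->
  (P [set w | (\sum_i \int[P]_v F i (sample_tuple Zs v) + t <=
               \sum_i F i (sample_tuple Zs w))%R]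
   <= (expR (- (2 * t ^+ 2 / (p%:R * #|I|%:R * (b - a) ^+ 2))))%:E)%E.
Proof.
move=> iid p0 I0 ab t0 mF Fab FD Dp.
have p0' : 0 < p%:R :> R by rewrite ltr0n.
have I0' : 0 < #|I|%:R :> R by rewrite ltr0n.
have ba0 : 0 < b - a by rewrite subr_gt0.
have [mZ _] := iid; have mW := measurable_sample_tuple mZ.
pose W := sample_tuple Zs; pose m i := \int[P]_v F i (W v).
have bF i : bounded_mfun (F i) by exact: bounded_mfun_itv (mF i) (Fab i).
(* Minimizer of [p * #|I| * s ^+ 2 * (b - a) ^+ 2 / 8 - s * t]. *)
pose s := 4 * t / (p%:R * #|I|%:R * (b - a) ^+ 2).
have s0 : 0 < s by rewrite divr_gt0 ?mulr_gt0 ?exprn_gt0.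
pose u i (x : n.-tuple T) := s * (F i x - m i).
have bu i : bounded_mfun (u i).
  by apply/bounded_mfunZ/bounded_mfunB => //; exact: bounded_mfun_cst.
pose X w := \sum_i (F i (W w) - m i).
have bX : bounded_mfun X.
  apply: bounded_mfun_sum => i; apply: bounded_mfunB.
    exact: bounded_mfun_comp (bF i) mW.
  exact: bounded_mfun_cst.
have [mX _] := bX.
pose Xm : {RV P >-> R} := HB.pack X (isMeasurableFun.Build _ _ _ _ X mX).
rewrite (_ : [set w | _] = [set w | t <= Xm w]); last first.
  by apply/seteqP; split => w /=; rewrite /X sumrB; lra.
apply: le_trans (chernoff Xm t s0) _.
rewrite /mmt_gen_fun unlock.
have bsX : bounded_mfun (fun w => expR (s * X w)).
  exact/bounded_mfun_expR/bounded_mfunZ.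
rewrite (_ : (\int[P]_w _)%E = (\int[P]_w expR (s * X w))%:E); last first.
  rewrite bounded_mfun_EFin_Rintegral//; apply: eq_integral => w _ /=.
  by rewrite mulrC.
rewrite -EFinM lee_fin.
apply: (@le_trans _ _ (expR (p%:R * #|I|%:R * s ^+ 2 * (b - a) ^+ 2 / 8) * expR (- (s * t)))).
  rewrite ler_pM2r ?expR_gt0//.
  rewrite (_ : (fun w => _) = fun w => expR (\sum_i u i (W w))); last first.
    by apply/funext => w; rewrite /X mulr_sumr.
  apply: le_trans (finner_expR iid p0 bu _ Dp) _.
    by move=> i x x' xx'; rewrite /u (FD _ _ _ xx').
  rewrite ler_expR.
  apply: (@le_trans _ _ (\sum_(i : I) p%:R * s ^+ 2 * (b - a) ^+ 2 / 8)).
    apply: ler_sum => i _; rewrite ler_pdivrMl//.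
    rewrite -[leRHS](expRK) ler_ln ?posrE ?expR_gt0//; last first.
      apply: Rintegral_expR_gt0; apply: bounded_mfunZ.
      exact: bounded_mfun_comp (bu i) mW.
    under eq_Rintegral do rewrite /u mulrA.
    have mFW : measurable_fun setT (fun w => F i (W w)) by exact: measurableT_comp.
    (* The parameter [p * s] contributes [p ^+ 2], of which the outer [p^-1] leaves one factor
       [p]. *)
    apply: (le_trans (hoeffding_mgf P (p%:R * s) mFW ab _)); first by move=> w.
    by rewrite ler_expR; lra.
  rewrite sumr_const -mulr_natr; lra.
rewrite -expRD ler_expR /s.
rewrite le_eqVlt; apply/orP; left; apply/eqP; field.
by rewrite !gt_eqF.
Qed.

End finner.

(** * Counting ordered pairs of distinct indices *)

Lemma sum_lift (V : nmodType) m (i : 'I_m.+1) (G : 'I_m.+1 -> V) :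
  \sum_(j | j != i) G j = \sum_(k < m) G (lift i k).
Proof.
rewrite (reindex_omap (lift i) (unlift i)) => [|j ji]; last first.
  by case: unliftP ji => [k ->|->]//; rewrite eqxx.
by apply: eq_bigl => k; rewrite eq_sym neq_lift liftK eqxx.
Qed.

(** [(i, l)] encodes the distinct indices [i] and [lift i l]. At most [m] pairs have [k] in first
    position ([A]) and at most [m] in second ([B]): in [B] the first component differs from [k] and
    determines the pair. *)
Lemma card_lift_pair m (k : 'I_m.+1) :
  (#|[pred x : 'I_m.+1 * 'I_m | (k == x.1) || (k == lift x.1 x.2)]| <= 2 * m)%N.
Proof.
pose A := [set (k, l) | l in 'I_m]%SET.
pose B := [set x : 'I_m.+1 * 'I_m | k == lift x.1 x.2]%SET.
apply: (@leq_trans #|A :|: B|).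
  apply/subset_leq_card/fintype.subsetP => -[i l]; rewrite !inE/= => /orP[/eqP <-|->].
    by rewrite imset_f.
  by rewrite orbT.
apply: leq_trans (leq_card_setU _ _) _; rewrite mul2n -addnn; apply: leq_add.
  by rewrite (leq_trans (leq_imset_card _ _))// card_ord.
have injB : {in B &, injective (fun x => x.1)}.
  move=> [i l] [i' l']; rewrite !inE/= => /eqP kE /eqP kE' ii'.
  by rewrite -ii' kE in kE' *; rewrite (lift_inj kE').
rewrite -(card_in_imset injB); apply: (@leq_trans #|predC1 k|); last first.
  by rewrite cardC1 card_ord.
apply/subset_leq_card/fintype.subsetP => _ /imsetP[[i l]] + ->; rewrite !inE/= => /eqP ->.
by rewrite neq_lift.
Qed.

(** * Tail bounds for averages *)

Section deviations.
Context {R : realType} {dO d : measure_display} {Omega : measurableType dO}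
  {T : measurableType d}.
Variables (P : probability Omega R) (mu : probability T R).

Lemma measurable_gt_set (X : Omega -> R) c :
  measurable_fun setT X -> measurable [set w | c < X w].
Proof.
move=> mX; rewrite (_ : [set w | _] = setT `&` X @^-1` `]c, +oo[%classic).
  exact: mX.
by apply/seteqP; split => w /=; rewrite in_itv/= andbT => -[].
Qed.

Variables (n : nat) (Zs : 'I_n -> Omega -> T).
Hypothesis iid : iid_sample P mu Zs.

Let mZ i : measurable_fun setT (Zs i). Proof. by case: iid. Qed.

(** The deviation is measured in units of [b - a] and the inequality in the event is strict, so that
    the degenerate range [a = b] is covered. *)
Lemma hoeffding_janson_mean (I : finType) (F : I -> n.-tuple T -> R)
    (D : I -> {pred 'I_n}) (p : nat) (a b c m : R) :
  (0 < p)%N -> (0 < #|I|)%N -> 0 < c ->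
  (forall i, measurable_fun setT (F i)) ->
  (forall i s, a <= F i s <= b) ->
  (forall i s s', (forall k, k \in D i -> tnth s k = tnth s' k) -> F i s = F i s') ->
  (forall k, (#|[pred i | k \in D i]| <= p)%N) ->
  (forall i, \int[P]_w F i (sample_tuple Zs w) = m) ->
  (P [set w | (m + c * (b - a) < #|I|%:R^-1 * \sum_i F i (sample_tuple Zs w))%R]
    <= (expR (- (2 * (#|I|%:R / p%:R) * c ^+ 2)))%:E)%E.
Proof.
move=> p0 I0 c0 mF Fab FD Dp mE.
have I0' : 0 < #|I|%:R :> R by rewrite ltr0n.
have p0' : 0 < p%:R :> R by rewrite ltr0n.
have bF i : bounded_mfun (F i) by exact: bounded_mfun_itv (mF i) (Fab i).
have mW := measurable_sample_tuple mZ.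
have [ab|ba] := ltP a b; last first.
  (* Here [a = b], every [F i] is constantly [a], and the event is empty. *)
  rewrite (_ : [set w | _] = set0) ?measure0 ?lee_fin ?expR_ge0//.
  apply/seteqP; split => w //=; have [i0 _] := card_gt0P I0.
  have FE i s : F i s = a by have := Fab i s; lra.
  have -> : m = a.
    rewrite -(mE i0) (_ : (fun w => _) = fun=> a) ?prob_Rintegral_cst//.
    by apply/funext => v; rewrite FE.
  have -> : b - a = 0 by have := Fab i0 (sample_tuple Zs w); lra.
  rewrite (eq_bigr (fun=> a)) => [|i _]; last exact: FE.
  by rewrite sumr_const -[a *+ _]mulr_natl mulrA mulVf ?gt_eqF// mul1r mulr0 addr0 ltxx.
have ba0 : 0 < b - a by rewrite subr_gt0.
have t0 : 0 < #|I|%:R * (c * (b - a)) by rewrite !mulr_gt0.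
have := hoeffding_janson iid p0 I0 ab t0 mF Fab FD Dp.
rewrite (_ : expR _ = expR (- (2 * (#|I|%:R / p%:R) * c ^+ 2))); last first.
  by congr expR; field; rewrite !gt_eqF.
apply: le_trans; apply: le_measure; rewrite ?inE.
- apply: measurable_gt_set; apply: measurable_funM => //.
  by apply: measurable_sum => i; exact: measurableT_comp.
- rewrite (_ : [set w | _] = ~` [set w | - (\sum_i \int[P]_v F i (sample_tuple Zs v) +
      #|I|%:R * (c * (b - a))) < - \sum_i F i (sample_tuple Zs w)]).
    apply/measurableC/measurable_gt_set/measurableT_comp => //.
    by apply: measurable_sum => i; exact: measurableT_comp.
  by apply/seteqP; split => w /=; rewrite ltrN2 leNgt => /negP.
have sumE : \sum_i \int[P]_v F i (sample_tuple Zs v) = #|I|%:R * m.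
  by rewrite (eq_bigr (fun=> m)) ?sumr_const ?mulr_natl.
by move=> w /=; rewrite sumE ltr_pdivlMl// => /ltW; rewrite mulrDr.
Qed.

Lemma bounded_mfun_sample_mean (g : T -> R) : bounded_mfun g ->
  bounded_mfun (fun w => n%:R^-1 * \sum_i g (Zs i w)).
Proof.
by move=> bg; apply/bounded_mfunZ/bounded_mfun_sum => i; exact: bounded_mfun_comp.
Qed.

Lemma Rintegral_sample_mean (g : T -> R) : (0 < n)%N -> bounded_mfun g ->
  \int[P]_w (n%:R^-1 * \sum_i g (Zs i w)) = \int[mu]_t g t.
Proof.
move=> n0 bg.
have bgZ i : bounded_mfun (fun w => g (Zs i w)) by exact: bounded_mfun_comp.
rewrite prob_RintegralZ; last exact: bounded_mfun_sum.
rewrite prob_Rintegral_sum// (eq_bigr (fun=> \int[mu]_t g t)) => [|i _].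
  rewrite sumr_const card_ord -[X in _ * X]mulr_natl mulrA mulVf ?mul1r//.
  by rewrite pnatr_eq0 -lt0n.
exact: Rintegral_iid.
Qed.

Lemma sample_mean_tail (g : T -> R) (a b c : R) :
  (0 < n)%N -> 0 < c -> measurable_fun setT g -> (forall t, a <= g t <= b) ->
  (P [set w | (\int[mu]_t g t + c * (b - a) < n%:R^-1 * \sum_i g (Zs i w))%R]
    <= (expR (- (2 * n%:R * c ^+ 2)))%:E)%E.
Proof.
move=> n0 c0 mg gab; have bg := bounded_mfun_itv mg gab.
pose F (i : 'I_n) (t : n.-tuple T) := g (tnth t i).
have FE i w : F i (sample_tuple Zs w) = g (Zs i w) by rewrite /F tnth_mktuple.
have := @hoeffding_janson_mean _ F (fun i => pred1 i) 1%N a b c (\int[mu]_t g t) isT.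
rewrite card_ord divr1; under eq_set do under eq_bigr do rewrite FE.
apply=> //.
- by move=> i; apply: measurableT_comp mg _; exact: measurable_tnth.
- by move=> i s; exact: gab.
- by move=> i s s' /(_ i); rewrite inE eqxx /F => ->.
- move=> k; rewrite -(card1 k) eq_leq//.
  by apply: fintype.eq_card => i; rewrite !inE eq_sym.
- by move=> i; under eq_Rintegral do rewrite FE; exact: Rintegral_iid.
Qed.

End deviations.

(** * Averages over ordered pairs of observations *)

Section ustatistic.
Context {R : realType} {dO d : measure_display} {Omega : measurableType dO}
  {T : measurableType d}.
Variables (P : probability Omega R) (mu : probability T R).
Variables (n : nat) (Zs : 'I_n -> Omega -> T).
Hypothesis iid : iid_sample P mu Zs.
Hypothesis n2 : (2 <= n)%N.

(** U-statistic of order two with a kernel that may be asymmetric. The outer index fills the second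
    argument, like the index that supplies [X1] in [hat_e_switch]. *)
Definition ustat (g : T * T -> R) (w : Omega) : R :=
  (n * n.-1)%:R^-1 * \sum_(i < n) \sum_(j < n | j != i) g (Zs j w, Zs i w).

Let mZ i : measurable_fun setT (Zs i). Proof. by case: iid. Qed.

Let bounded_mfun_pairs (g : T * T -> R) i j : bounded_mfun g ->
  bounded_mfun (fun w => g (Zs j w, Zs i w)).
Proof. by move=> bg; apply: bounded_mfun_comp bg _; exact: measurable_fun_pair. Qed.

Lemma bounded_mfun_ustat (g : T * T -> R) : bounded_mfun g -> bounded_mfun (ustat g).
Proof.
move=> bg; apply/bounded_mfunZ/bounded_mfun_sum => i.
under eq_fun do rewrite -big_filter.
by apply: bounded_mfun_sum => j; exact: bounded_mfun_pairs.
Qed.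

Lemma Rintegral_ustat (g : T * T -> R) : bounded_mfun g ->
  \int[P]_w ustat g w = \int[mu]_s \int[mu]_t g (t, s).
Proof.
move=> bg; set m := RHS.
have bi i : bounded_mfun (fun w => \sum_(j < n | j != i) g (Zs j w, Zs i w)).
  under eq_fun do rewrite -big_filter.
  by apply: bounded_mfun_sum => j; exact: bounded_mfun_pairs.
rewrite /ustat prob_RintegralZ; last exact: bounded_mfun_sum.
rewrite prob_Rintegral_sum// (eq_bigr (fun=> n.-1%:R * m)) => [|i _].
  rewrite sumr_const card_ord -[X in _ * X]mulr_natl mulrA -natrM mulrA.
  by rewrite mulVf ?mul1r// pnatr_eq0 -lt0n muln_gt0; case: n n2 => [|[]].
under eq_Rintegral do rewrite -big_filter.
rewrite prob_Rintegral_sum => [|j]; last exact: bounded_mfun_pairs.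
rewrite big_filter (eq_bigr (fun=> m)) => [|j ji]; last exact: (Rintegral_iid_pair iid ji bg).
by rewrite sumr_const cardC1 card_ord mulr_natl.
Qed.

End ustatistic.

Lemma ustat_tail (R : realType) (dO d : measure_display) (Omega : measurableType dO)
    (T : measurableType d) (P : probability Omega R) (mu : probability T R)
    (n : nat) (Zs : 'I_n -> Omega -> T) (g : T * T -> R) (a b c : R) :
  iid_sample P mu Zs -> (2 <= n)%N -> 0 < c ->
  measurable_fun setT g -> (forall z, a <= g z <= b) ->
  (P [set w | (\int[mu]_s \int[mu]_t g (t, s) + c * (b - a) < ustat Zs g w)%R]
    <= (expR (- (n%:R * c ^+ 2)))%:E)%E.
Proof.
move=> iid n2 c0 mg gab; have bg := bounded_mfun_itv mg gab; have [mZ _] := iid.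
rewrite /ustat; case: n n2 Zs iid mZ => [//|m] m1 Z' iid' mZ'.
(* Through [lift], ordered pairs of distinct indices become a product type. *)
pose F (x : 'I_m.+1 * 'I_m) (t : m.+1.-tuple T) := g (tnth t (lift x.1 x.2), tnth t x.1).
have FE x w : F x (sample_tuple Z' w) = g (Z' (lift x.1 x.2) w, Z' x.1 w).
  by rewrite /F !tnth_mktuple.
pose D (x : 'I_m.+1 * 'I_m) : {pred 'I_m.+1} := [pred k | (k == x.1) || (k == lift x.1 x.2)].
have m0 : (0 < m)%N by [].
have := @hoeffding_janson_mean _ _ _ _ _ P mu _ Z' iid' _ F D (2 * m)%N a b c
  (\int[mu]_s \int[mu]_t g (t, s)).
rewrite card_prod !card_ord.
under eq_set => w.
  rewrite -(pair_bigA _ (fun i j => F (i, j) (sample_tuple Z' w)))/=.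
  under eq_bigr => i _.
    under eq_bigr do rewrite FE/=.
    rewrite -(sum_lift i (fun j => g (Z' j w, Z' i w))).
    over.
  over.
(* The number of pairs over the multiplicity [2 * m] is [m.+1 / 2]; cancelling [m] relies on
   [2 <= n]. *)
rewrite (_ : 2 * (_ / _) = m.+1%:R); last first.
  by rewrite !natrM; field; rewrite pnatr_eq0 -lt0n.
apply=> //.
- by rewrite muln_gt0.
- by rewrite muln_gt0.
- move=> x; apply: measurableT_comp mg _.
  by apply: measurable_fun_pair; exact: measurable_tnth.
- by move=> x s; exact: gab.
- by move=> x s s' ss'; rewrite /F !ss' ?inE ?eqxx ?orbT.
- by move=> k; apply: card_lift_pair.
- move=> x; under eq_Rintegral do rewrite FE.
  by apply: (Rintegral_iid_pair iid') => //; rewrite eq_sym neq_lift.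
Qed.

(** * Perturbation of a ratio and inversion of tail bounds *)

(** The worst second ratio is [(x - a) / (y + b)]. The gap then splits as
    [x * b / (y * (y + b)) + a / (y + b)], where each term is nondecreasing in [x] and nonincreasing
    in [y]. *)
Lemma ratio_gap (R : realFieldType) (x y x' y' a b X y0 : R) :
  0 < y0 <= y -> 0 <= x <= X -> 0 <= a -> 0 <= b ->
  0 <= x' -> x - a <= x' -> 0 < y' <= y + b ->
  x / y - x' / y' <= X / y0 - (X - a) / (y0 + b).
Proof.
move=> /andP[y00 y0y] /andP[x0 xX] a0 b0 x'0 xx' /andP[y'0 y'y].
have y_gt0 : 0 < y by lra.
have yb : 0 < y + b by lra.
have y0b : 0 < y0 + b by lra.
have h1 : (x - a) / (y + b) <= x' / y'.
  (* For [x <= a] the numerator is nonpositive and comparing denominators would go the wrong way;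
     the signs of the two sides suffice. *)
  have [xa|xa] := leP x a.
    by apply: (@le_trans _ _ 0); [rewrite pmulr_lle0 ?invr_gt0//|rewrite divr_ge0// ltW]; lra.
  by rewrite ler_pM// ?lef_pV2 ?posrE// ?invr_ge0 ?ltW//; lra.
have h2 : b / (y * (y + b)) <= b / (y0 * (y0 + b)).
  rewrite ler_wpM2l// lef_pV2 ?posrE ?mulr_gt0// ler_pM//; lra.
have h3 : a / (y + b) <= a / (y0 + b).
  by rewrite ler_wpM2l// lef_pV2 ?posrE//; lra.
have h4 : x * (b / (y * (y + b))) <= X * (b / (y0 * (y0 + b))).
  by rewrite ler_pM// divr_ge0// mulr_ge0// ltW.
have e1 : x / y - (x - a) / (y + b) = x * (b / (y * (y + b))) + a / (y + b).
  by field; rewrite !gt_eqF.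
have e2 : X / y0 - (X - a) / (y0 + b) = X * (b / (y0 * (y0 + b))) + a / (y0 + b).
  by field; rewrite !gt_eqF.
lra.
Qed.

(** Converts a deviation into a failure probability; it serves [x = 3 / delta] and
    [x = 6 / delta]. *)
Lemma expRN_sqr_sqrt_ln (R : realType) (k x : R) : 0 < k -> 1 < x ->
  expR (- (k * Num.sqrt (ln x / k) ^+ 2)) = x^-1.
Proof.
move=> k0 x1; rewrite sqr_sqrtr; last by rewrite divr_ge0 ?ln_ge0 ?ltW.
by rewrite mulrC divfK ?gt_eqF// expRN lnK// posrE; lra.
Qed.

(** * Outer-probability bounds and high-probability deviations *)

Section prob_le.
Context {R : realType} {dO : measure_display} {Omega : measurableType dO}.
Variable P : probability Omega R.
Implicit Types (A B : set Omega) (x y : R).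

Lemma prob_leS A B x y : A `<=` B -> x <= y -> prob_le P B x -> prob_le P A y.
Proof.
move=> AB xy [C mC [BC PC]]; exists C => //; split; first exact: subset_trans BC.
by rewrite (le_trans PC)// lee_fin.
Qed.

Lemma prob_leU A B x y :
  prob_le P A x -> prob_le P B y -> prob_le P (A `|` B) (x + y).
Proof.
move=> [C mC [AC PC]] [D mD [BD PD]]; exists (C `|` D); first exact: measurableU.
split; first exact: setUSS.
by rewrite EFinD (le_trans (measureU2 _ mC mD))// leeD.
Qed.

Lemma prob_le_setC_ae A : measurable A -> P A = 1%E -> prob_le P (~` A) 0.
Proof.
move=> mA PA; exists (~` A); first exact: measurableC.
by split => //; rewrite probability_setC// PA subee.
Qed.

Lemma measurable_ge_set (X : Omega -> R) c :
  measurable_fun setT X -> measurable [set w | c <= X w].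
Proof.
move=> mX; rewrite (_ : [set w | _] = setT `&` X @^-1` `[c, +oo[%classic).
  exact: mX.
by apply/seteqP; split => w /=; rewrite in_itv/= andbT => -[].
Qed.

(** [X] is replaced by [max c X], which equals it almost surely and satisfies the bound
    everywhere. *)
Lemma Rintegral_ge_ae (X : Omega -> R) c : bounded_mfun X ->
  P [set w | c <= X w] = 1%E -> c <= \int[P]_w X w.
Proof.
move=> bX Xc; have [mX [M XM]] := bX.
pose Y w := Num.max c (X w).
have mY : measurable_fun setT Y by exact: measurable_maxr.
have bY : bounded_mfun Y.
  apply: (@bounded_mfun_itv _ _ _ _ c (Num.max c M)) => // w.
  rewrite le_max lexx/= ge_max !le_max lexx/=; apply/orP; right.
  exact: le_trans (ler_norm _) (XM w).
have -> : \int[P]_w X w = \int[P]_w Y w.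
  congr fine; apply: ae_eq_integral => //; try exact/measurable_EFinP.
  have [N mN [sN PN]] := prob_le_setC_ae (measurable_ge_set c mX) Xc.
  exists N; split => //; first by apply/eqP; rewrite eq_le PN measure_ge0.
  move=> w /= XY; apply: sN => /= cX; apply: XY => _.
  by rewrite /Y max_r.
rewrite -[leLHS](prob_Rintegral_cst P); apply: prob_le_Rintegral => //.
  exact: bounded_mfun_cst.
by move=> w; rewrite /Y le_max lexx.
Qed.

Context {d : measure_display} {T : measurableType d} (mu : probability T R).
Variables (n : nat) (Zs : 'I_n -> Omega -> T).
Hypothesis iid : iid_sample P mu Zs.
Hypothesis n2 : (2 <= n)%N.

Let n0 : (0 < n)%N. Proof. exact: leq_trans n2. Qed.
Let n0' : 0 < n%:R :> R. Proof. by rewrite ltr0n. Qed.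

Let sqrt_gt0 (k x : R) : 0 < k -> 1 < x -> 0 < Num.sqrt (ln x / k).
Proof. by move=> k0 x1; rewrite sqrtr_gt0 divr_gt0// ln_gt0. Qed.

Lemma sample_mean_prob_gt (g : T -> R) (a b x : R) :
  1 < x -> measurable_fun setT g -> (forall t, a <= g t <= b) ->
  prob_le P [set w | (\int[mu]_t g t + (b - a) * Num.sqrt (ln x / (2 * n%:R)) <
                      n%:R^-1 * \sum_i g (Zs i w))%R] x^-1.
Proof.
move=> x1 mg gab; have k0 : 0 < 2 * n%:R :> R by rewrite mulr_gt0.
set c := Num.sqrt _; exists [set w | (\int[mu]_t g t + (b - a) * c <
                      n%:R^-1 * \sum_i g (Zs i w))%R].
  apply: measurable_gt_set.
  by have [] := bounded_mfun_sample_mean iid (bounded_mfun_itv mg gab).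
split => //; rewrite -(expRN_sqr_sqrt_ln k0 x1) mulrC.
by apply: (sample_mean_tail iid) => //; exact: sqrt_gt0.
Qed.

(** Upper tail of [-1 * g], whose range [[- b, - a]] has the same width. *)
Lemma sample_mean_prob_lt (g : T -> R) (a b x : R) :
  1 < x -> measurable_fun setT g -> (forall t, a <= g t <= b) ->
  prob_le P [set w | (n%:R^-1 * \sum_i g (Zs i w) <
                      \int[mu]_t g t - (b - a) * Num.sqrt (ln x / (2 * n%:R)))%R] x^-1.
Proof.
move=> x1 mg gab.
have bg := bounded_mfun_itv mg gab.
have mNg : measurable_fun setT (fun t => -1 * g t) by exact: measurable_funM.
have gab' t : - b <= -1 * g t <= - a by have := gab t; lra.
apply: prob_leS (sample_mean_prob_gt x1 mNg gab') => // w /=.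
by rewrite prob_RintegralZ// -mulr_sumr; lra.
Qed.

Lemma ustat_prob_gt (g : T * T -> R) (a b x : R) :
  1 < x -> measurable_fun setT g -> (forall t, a <= g t <= b) ->
  prob_le P [set w | (\int[mu]_s \int[mu]_t g (t, s) +
    (b - a) * Num.sqrt (ln x / n%:R) < ustat Zs g w)%R] x^-1.
Proof.
move=> x1 mg gab.
set c := Num.sqrt _; exists [set w | (\int[mu]_s \int[mu]_t g (t, s) +
    (b - a) * c < ustat Zs g w)%R].
  apply: measurable_gt_set.
  by have [] := bounded_mfun_ustat iid (bounded_mfun_itv mg gab).
split => //; rewrite -(expRN_sqr_sqrt_ln n0' x1) mulrC.
by apply: (ustat_tail iid) => //; exact: sqrt_gt0.
Qed.

Lemma ustat_prob_lt (g : T * T -> R) (a b x : R) :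
  1 < x -> measurable_fun setT g -> (forall t, a <= g t <= b) ->
  prob_le P [set w | (ustat Zs g w <
    \int[mu]_s \int[mu]_t g (t, s) - (b - a) * Num.sqrt (ln x / n%:R))%R] x^-1.
Proof.
move=> x1 mg gab.
have bg := bounded_mfun_itv mg gab.
have mNg : measurable_fun setT (fun t => -1 * g t) by exact: measurable_funM.
have gab' t : - b <= -1 * g t <= - a by have := gab t; lra.
apply: prob_leS (ustat_prob_gt x1 mNg gab') => // w /=.
have -> : \int[mu]_s \int[mu]_t (-1 * g (t, s)) = -1 * \int[mu]_s \int[mu]_t g (t, s).
  rewrite -prob_RintegralZ; last exact: bounded_mfun_Rintegral.
  apply: eq_Rintegral => s _; rewrite prob_RintegralZ//.
  exact: bounded_mfun_pair.
have -> : ustat Zs (fun t => -1 * g t) w = -1 * ustat Zs g w.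
  rewrite /ustat mulrCA; congr (_ * _); rewrite mulr_sumr.
  by apply: eq_bigr => i _; rewrite mulr_sumr.
lra.
Qed.

End prob_le.

(** * Deviation of model reliance for one fixed model *)

Section single_model.
Context {R : realType} {d1 d2 d3 dO : measure_display}
  {Y : measurableType d1} {X1 : measurableType d2} {X2 : measurableType d3}
  {Omega : measurableType dO} (P : probability Omega R)
  (mu : probability (Zt Y X1 X2) R)
  (L : model Y X1 X2 -> Zt Y X1 X2 -> R) (fref f : model Y X1 X2)
  (n : nat) (Zs : 'I_n -> Omega -> Zt Y X1 X2)
  (delta Bind Bref borig Bswitch : R).
Hypotheses (n2 : (2 <= n)%N) (iid : iid_sample P mu Zs).
Hypotheses (mLref : measurable_fun setT (L fref)) (mLf : measurable_fun setT (L f)).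
Hypothesis delta01 : 0 < delta < 1.
Hypothesis Lf : forall z, 0 <= L f z <= Bind.
Hypothesis Lref : forall z, `|L f z - L fref z| <= Bref.
Hypothesis orig1 :
  P [set w | 0 < borig <= hat_e_orig L (fun i => Zs i w) f] = 1%E.
Hypothesis switch1 :
  P [set w | hat_e_switch L (fun i => Zs i w) f <= Bswitch] = 1%E.

Let n0 : (0 < n)%N. Proof. exact: leq_trans n2. Qed.
Let hor w := hat_e_orig L (fun i => Zs i w) f.
Let hsw w := hat_e_switch L (fun i => Zs i w) f.
Let c_sw := Num.sqrt (ln (6 / delta) / n%:R).
Let c_or := Num.sqrt (ln (6 / delta) / (2 * n%:R)).

Let bLf : bounded_mfun (L f). Proof. exact: bounded_mfun_itv mLf Lf. Qed.

(** Kernel of the switched loss: the first argument supplies [Y] and [X2], the second [X1]. Thus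
    [hat_e_switch] is [ustat Zs g], with mean [e_switch]. *)
Let g (z : Zt Y X1 X2 * Zt Y X1 X2) := L f ((z.1.1.1, z.2.1.2), z.1.2).

Let mg : measurable_fun setT g.
Proof.
have m1 := @measurable_fst _ _ (Zt Y X1 X2) (Zt Y X1 X2).
have m2 := @measurable_snd _ _ (Zt Y X1 X2) (Zt Y X1 X2).
have mYX1 := @measurable_fst _ _ (Y * X1)%type X2.
apply: measurableT_comp mLf _; apply: measurable_fun_pair.
  apply: measurable_fun_pair.
    exact: measurableT_comp measurable_fst (measurableT_comp mYX1 m1).
  exact: measurableT_comp measurable_snd (measurableT_comp mYX1 m2).
exact: measurableT_comp measurable_snd m1.
Qed.

Let gB z : 0 <= g z <= Bind. Proof. exact: Lf. Qed.
Let bg : bounded_mfun g. Proof. exact: bounded_mfun_itv mg gB. Qed.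

Let eswE : e_switch mu L f = \int[mu]_s \int[mu]_t g (t, s).
Proof.
congr fine; apply: eq_integral => s _.
by rewrite bounded_mfun_EFin_Rintegral//; exact: bounded_mfun_pair.
Qed.

Let eorE : e_orig mu L f = \int[mu]_z L f z. Proof. by []. Qed.

Let bhor : bounded_mfun hor. Proof. exact: (bounded_mfun_sample_mean iid). Qed.
Let bhsw : bounded_mfun hsw. Proof. exact: (bounded_mfun_ustat iid bg). Qed.

(** Positivity is part of the almost sure event, which would otherwise be empty. *)
Lemma borig_gt0 : 0 < borig.
Proof.
rewrite ltNge; apply/negP => b0; move: orig1.
rewrite (_ : [set w | _] = set0) ?measure0; last first.
  by apply/seteqP; split => w //= /andP[/lt_geF]; rewrite b0.
by move/eqP; rewrite eqe eq_sym oner_eq0.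
Qed.

Let orig1' : P [set w | borig <= hor w] = 1%E.
Proof.
rewrite -orig1; congr (P _).
by apply/seteqP; split => w /=; rewrite borig_gt0.
Qed.

Let switch1' : P [set w | - Bswitch <= - hsw w] = 1%E.
Proof.
by rewrite -switch1; congr (P _); apply/seteqP; split => w /=; rewrite lerN2.
Qed.

(** The empirical loss is unbiased, so its almost sure lower bound passes to the population loss. *)
Lemma borig_le_e_orig : borig <= e_orig mu L f.
Proof.
rewrite eorE -(Rintegral_sample_mean iid n0 bLf).
exact: Rintegral_ge_ae.
Qed.

Lemma e_switch_le_Bswitch : e_switch mu L f <= Bswitch.
Proof.
rewrite eswE -(Rintegral_ustat iid n2 bg).
have bN : bounded_mfun (fun w => -1 * hsw w) by exact: bounded_mfunZ.
have : - Bswitch <= \int[P]_w (-1 * hsw w).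
  apply: Rintegral_ge_ae => //; rewrite -switch1'.
  by congr (P _); apply/seteqP; split => w /=; rewrite mulN1r.
by rewrite prob_RintegralZ// mulN1r lerN2.
Qed.

Lemma e_switch_ge0 : 0 <= e_switch mu L f.
Proof.
rewrite eswE; apply: Rintegral_ge0 => s _; apply: Rintegral_ge0 => t _.
by have /andP[] := gB (t, s).
Qed.

Lemma hat_e_switch_ge0 w : 0 <= hsw w.
Proof.
rewrite /hsw /hat_e_switch mulr_ge0 ?invr_ge0//.
apply: sumr_ge0 => i _; apply: sumr_ge0 => j _.
by have /andP[] := Lf (((Zs j w).1.1, (Zs i w).1.2), (Zs j w).2).
Qed.

Let x6 : 1 < 6 / delta.
Proof. by have /andP[de0 de1] := delta01; rewrite ltr_pdivlMr//; lra. Qed.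
Let x3 : 1 < 3 / delta.
Proof. by have /andP[de0 de1] := delta01; rewrite ltr_pdivlMr//; lra. Qed.

(** Two null events, where an aggregate bound fails, and the event that [f] violates the loss
    constraint of the enlarged empirical Rashomon set. *)
Let bad eps := [set w | ~ (borig <= hor w)] `|` [set w | ~ (hsw w <= Bswitch)] `|`
  [set w | hat_e_orig L (fun i => Zs i w) fref + (eps +
     2 * Bref * Num.sqrt (ln (3 / delta) / (2 * n%:R))) < hor w].

(** Hoeffding's inequality is applied to the single function [L f - L fref], of range width
    [2 * Bref], at level [delta / 3]. *)
Let prob_bad eps : e_orig mu L f <= e_orig mu L fref + eps ->
  prob_le P (bad eps) (delta / 3).
Proof.
move=> feps.
have h1 : prob_le P (~` [set w | borig <= hor w]) 0.
  by apply: prob_le_setC_ae => //; apply: measurable_ge_set; case: bhor.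
have h2 : prob_le P (~` [set w | - Bswitch <= - hsw w]) 0.
  apply: prob_le_setC_ae => //; apply: measurable_ge_set.
  by apply: measurableT_comp => //; case: bhsw.
have mD : measurable_fun setT (fun z => L f z - L fref z) by exact: measurable_funB.
have DB z : - Bref <= L f z - L fref z <= Bref by rewrite -ler_norml.
(* Boundedness of [L fref] follows from the individual and relative bounds on [f]. *)
have bLref : bounded_mfun (L fref).
  apply: (@bounded_mfun_itv _ _ _ _ (- Bref) (Bind + Bref)) => // z.
  by have := DB z; have := Lf z; lra.
have h3 := sample_mean_prob_gt iid n2 x3 mD DB.
apply: prob_leS (prob_leU (prob_leU h1 h2) h3).
  move=> w [[]|] /= h; [by left; left|left; right => /=|right => /=].
    by rewrite lerN2.
  move: h; rewrite /hor /hat_e_orig sumrB mulrBr prob_RintegralB//.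
  by rewrite -eorE (_ : \int[mu]_z L fref z = e_orig mu L fref)//; move: feps; lra.
by rewrite invf_div; lra.
Qed.

(** An event of probability one is nonempty, which provides an actual data point. *)
Let Bind_ge0 : 0 <= Bind.
Proof.
have [w _] : [set w | 0 < borig <= hor w] !=set0.
  apply/set0P/eqP => E; move: orig1; rewrite [X in P X]E measure0.
  by move/eqP; rewrite eqe eq_sym oner_eq0.
by have := Lf (Zs (Ordinal n0) w); lra.
Qed.

Let c_sw_ge0 : 0 <= Bind * c_sw. Proof. by rewrite mulr_ge0 ?sqrtr_ge0. Qed.
Let c_or_ge0 : 0 <= Bind * c_or. Proof. by rewrite mulr_ge0 ?sqrtr_ge0. Qed.

Let Q := Bswitch / borig - (Bswitch - Bind * c_sw) / (borig + Bind * c_or).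
Let eps1 eps := eps + 2 * Bref * Num.sqrt (ln (3 / delta) / (2 * n%:R)).

(** [ratio_gap] with the population losses as [(x, y)] and the empirical ones as [(x', y')]; hence a
    lower tail for the U-statistic and an upper tail for the mean. *)
Lemma MR_le_hat_MR eps : e_orig mu L f <= e_orig mu L fref + eps ->
  prob_le P [set w | ~ (hat_e_orig L (fun i => Zs i w) f <=
                        hat_e_orig L (fun i => Zs i w) fref + eps1 eps /\
                        MR mu L f <= hat_MR L (fun i => Zs i w) f + Q)] delta.
Proof.
move=> feps; have b0 := borig_gt0.
have hU := ustat_prob_lt iid n2 x6 mg gB.
have hM := sample_mean_prob_gt iid n2 x6 mLf Lf.
(* The levels [delta / 3], [delta / 6] and [delta / 6] add up to at most [delta]. *)
apply: prob_leS (prob_leU (prob_bad feps) (prob_leU hU hM)); last first.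
  by rewrite !invf_div; move: delta01; lra.
move=> w; apply: contra_notP => /not_orP[/not_orP[/not_orP[/= /contrapT bh _]]].
move=> /negP; rewrite -leNgt => fin /not_orP[/= /negP + /negP].
rewrite -!leNgt subr0 -eswE -eorE => swU orU; split => //.
rewrite -lerBlDl; apply: ratio_gap c_sw_ge0 c_or_ge0 _ _ _ => //.
- by rewrite b0 borig_le_e_orig.
- by rewrite e_switch_ge0 e_switch_le_Bswitch.
- exact: hat_e_switch_ge0.
- by rewrite (lt_le_trans b0 bh).
Qed.

(** The roles in [ratio_gap] are exchanged: the empirical losses are now [(x, y)], their aggregate
    bounds hold outside [bad], and both tails are reversed. *)
Lemma hat_MR_le_MR eps : e_orig mu L f <= e_orig mu L fref + eps ->
  prob_le P [set w | ~ (hat_e_orig L (fun i => Zs i w) f <=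
                        hat_e_orig L (fun i => Zs i w) fref + eps1 eps /\
                        hat_MR L (fun i => Zs i w) f - Q <= MR mu L f)] delta.
Proof.
move=> feps; have b0 := borig_gt0.
have hU := ustat_prob_gt iid n2 x6 mg gB.
have hM := sample_mean_prob_lt iid n2 x6 mLf Lf.
apply: prob_leS (prob_leU (prob_bad feps) (prob_leU hU hM)); last first.
  by rewrite !invf_div; move: delta01; lra.
move=> w; apply: contra_notP => /not_orP[/not_orP[/not_orP[/= /contrapT bh /contrapT hB]]].
move=> /negP; rewrite -leNgt => fin /not_orP[/= /negP + /negP].
rewrite -!leNgt subr0 -eswE -eorE => swU orU; split => //.
rewrite lerBlDr -lerBlDl; apply: ratio_gap c_sw_ge0 c_or_ge0 _ _ _ => //.
- by rewrite b0.
- by rewrite hat_e_switch_ge0.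
- exact: e_switch_ge0.
- by rewrite lerBlDr.
- by rewrite (lt_le_trans b0 borig_le_e_orig) -lerBlDr.
Qed.

End single_model.

(** * Passage to the extrema over the Rashomon sets *)

Unset Implicit Arguments.

Theorem theorem6 (R : realType) (d1 d2 d3 dO : measure_display)
  (Y : measurableType d1) (X1 : measurableType d2) (X2 : measurableType d3)
  (Omega : measurableType dO) (P : probability Omega R)
  (mu : probability (Zt Y X1 X2) R)
  (F : set (model Y X1 X2)) (L : model Y X1 X2 -> Zt Y X1 X2 -> R)
  (fref : model Y X1 X2)
  (n : nat) (Zs : 'I_n -> Omega -> Zt Y X1 X2)
  (eps delta Bind Bref borig Bswitch : R)
  (fplus fminus : model Y X1 X2) :
  (* standing assumptions *)
  (2 <= n)%N ->
  iid_sample P mu Zs ->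
  F fref ->
  (forall f, F f -> forall z, 0 <= L f z) ->
  (forall f, F f -> measurable_fun setT (L f)) ->
  (forall f, F f -> (\int[mu]_z (L f z)%:E < +oo)%E) ->
  (forall f, F f ->
     (\int[mu]_za \int[mu]_zb (L f ((zb.1.1, za.1.2), zb.2))%:E < +oo)%E) ->
  (* parameters *)
  0 <= eps -> 0 < delta < 1 ->
  (* f_{+,eps} in argmax, f_{-,eps} in argmin of MR over R(eps) *)
  rashomon mu L F fref eps fplus ->
  (forall g, rashomon mu L F fref eps g -> MR mu L g <= MR mu L fplus) ->
  rashomon mu L F fref eps fminus ->
  (forall g, rashomon mu L F fref eps g -> MR mu L fminus <= MR mu L g) ->
  (* bounded individual, relative and aggregate loss for f_{+,eps}, f_{-,eps} *)
  (forall f, f = fplus \/ f = fminus ->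
     [/\ forall z, 0 <= L f z <= Bind,
         forall z, `|L f z - L fref z| <= Bref,
         P [set w | 0 < borig <= hat_e_orig L (fun i => Zs i w) f] = 1%E &
         P [set w | hat_e_switch L (fun i => Zs i w) f <= Bswitch] = 1%E]) ->
  let eps1 := eps + 2 * Bref * Num.sqrt (ln (3 / delta) / (2 * n%:R)) in
  let Q1 := Bswitch / borig
            - (Bswitch - Bind * Num.sqrt (ln (6 / delta) / n%:R))
              / (borig + Bind * Num.sqrt (ln (6 / delta) / (2 * n%:R))) in
  prob_le P [set w | (MCR_plus mu L F fref eps >
                      hat_MCR_plus L F fref eps1 (fun i => Zs i w) + Q1%:E)%E]
          delta /\
  prob_le P [set w | (MCR_minus mu L F fref eps <
                      hat_MCR_minus L F fref eps1 (fun i => Zs i w) - Q1%:E)%E]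
          delta.
Proof.
move=> n2 iid Fref L0 mL _ _ eps0 delta01 fpR fpmax fmR fmmin Hf eps1 Q1.
have Fp := fpR.1; have Fm := fmR.1.
have [Lp Lrefp origp swp] := Hf fplus (or_introl erefl).
have [Lm Lrefm origm swm] := Hf fminus (or_intror erefl).
split.
  (* On the good event [fplus] competes in [hat_MCR_plus], whereas [MCR_plus] is at most its
     population reliance. *)
  apply: prob_leS (MR_le_hat_MR n2 iid (mL _ Fref) (mL _ Fp) delta01 Lp Lrefp
    origp swp fpR.2) => // w /= + [inR MRle].
  apply/negP; rewrite -leNgt.
  apply: (@le_trans _ _ (MR mu L fplus)%:E).
    by apply: ge_ereal_sup => _ [h hR <-]; rewrite lee_fin fpmax.
  apply: (@le_trans _ _ (hat_MR L (fun i => Zs i w) fplus + Q1)%:E).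
    by rewrite lee_fin.
  rewrite EFinD leeD2r//; apply: ereal_sup_ubound; exists fplus => //.
  by right; split.
(* Mirror image, with [fminus] and infima. *)
apply: prob_leS (hat_MR_le_MR n2 iid (mL _ Fref) (mL _ Fm) delta01 Lm Lrefm
  origm swm fmR.2) => // w /= + [inR MRle].
apply/negP; rewrite -leNgt.
apply: (@le_trans _ _ (MR mu L fminus)%:E); last first.
  by apply: le_ereal_inf_tmp => _ [h hR <-]; rewrite lee_fin fmmin.
apply: (@le_trans _ _ (hat_MR L (fun i => Zs i w) fminus - Q1)%:E); last first.
  by rewrite lee_fin.
rewrite EFinB leeD2r//; apply: ereal_inf_lbound; exists fminus => //.
by right; split.
Qed.
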